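(* Let $X_1,X_2,\dotsc$ be independent and identically distributed real random variables on a probability space $(\Omega,\mathcal{F},P)$. Suppose that $V[X_1]>0$ and there exist reals $a$ and $b$ with $a<b$ such that $a\le X_1\le b$ holds almost surely. Consider the following property of $\omega\in\Omega$: for every real $t>0$, the following conditions (i) and (ii) are equivalent: (i) There exists $M\in\mathbb{N}^+$ such that for every integer $n\ge M$ and every $k\in\mathbb{N}^+$, if $k\ge n^t$ then $$\left|\frac{1}{k}\sum_{i=1}^k X_i(\omega)-E[X_1]\right|<\frac{1}{n}.$$ (ii) $t>2$. Then the set of $\omega\in\Omega$ with this property is $\mathcal{F}$-measurable, and the property holds almost surely.
   Context: $\mathbb{N}^+$ is the set of positive integers. $(\Omega,\mathcal{F},P)$ is a general probability space (no computability assumption), and $E[X]$, $V[X]$ denote the mean and variance of a real random variable $X$. *)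

(* Defs.v *)
From HB Require Import structures.
From mathcomp Require Import all_boot all_order all_algebra finmap.
From mathcomp Require Import all_classical all_reals all_analysis.

Set Implicit Arguments.
Unset Strict Implicit.
Unset Printing Implicit Defensive.

Import Order.TTheory GRing.Theory Num.Theory.
Import numFieldNormedType.Exports.

Local Open Scope classical_set_scope.
Local Open Scope ring_scope.

(* Sequences are indexed from 0 throughout: [X i] stands for X_{i+1}. *)

Definition mutually_independent (d : measure_display) (T : measurableType d)
    (R : realType) (P : probability T R) (X : nat -> {RV P >-> R}) : Prop :=
  forall (J : {fset nat}) (B : nat -> set R),
    (forall i, measurable (B i)) ->
    P (\bigcap_(i in [set` J]) (X i @^-1` B i)) =
    (\prod_(i <- J) P (X i @^-1` B i))%E.

(* Laws are compared on Borel sets only: [distribution P Y] is a function on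
   all subsets of R, whose values off the sigma-algebra carry no meaning. *)
Definition identically_distributed (d : measure_display) (T : measurableType d)
    (R : realType) (P : probability T R) (X : nat -> {RV P >-> R}) : Prop :=
  forall (i j : nat) (B : set R), measurable B ->
    distribution P (X i) B = distribution P (X j) B.

(* [fine] is harmless whenever [X 0] is integrable, e.g. a.s. bounded. *)
Definition rate_condition (d : measure_display) (T : measurableType d)
    (R : realType) (P : probability T R) (X : nat -> {RV P >-> R})
    (w : T) (t : R) : Prop :=
  exists M : nat, (0 < M)%N /\
    forall n : nat, (M <= n)%N -> forall k : nat, (0 < k)%N ->
      n%:R `^ t <= k%:R ->
      `| k%:R^-1 * (\sum_(i < k) X i w) - fine 'E_P[X 0%N] | < n%:R^-1.

(* Main.v *)
Require Import Defs.
From HB Require Import structures.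
From mathcomp Require Import all_boot all_order all_algebra finmap.
From mathcomp Require Import all_classical all_reals all_analysis.
From mathcomp Require Import measurable_realfun ring lra.

(* Write D for the centred sum of n consecutive variables, mu for the mean and
   s for the variance. Since the variables are independent and bounded,
   E exp(u D / sqrt n) = (E exp(u (X_1 - mu) / sqrt n)) ^ n lies between
   exp(u^2 s / 8) and exp(2 u^2 s) for n large. The upper bound with u = 1, -1
   and Markov's inequality give P(|D| >= x sqrt n) <= K exp(-x), so by
   Borel-Cantelli the centred partial sums S_k are eventually below k^(1-1/t)
   for every t > 2, which is (i). For t <= 2, (i) would force
   |S_(4^j)| < 2^j for j large, hence S_(4^(j+1)) - S_(4^j) < 3 * 2^j.
   Applying the Paley-Zygmund argument to exp(u D / sqrt n) with u large shows
   that each of these independent events has probability at most 1 - q for some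
   q > 0, so almost surely they do not all occur from some j on. Condition (i)
   is monotone in t, so only t = 2 and t = 2 + 1/m matter: this gives
   measurability. *)

Set Implicit Arguments.
Unset Strict Implicit.
Unset Printing Implicit Defensive.

Import Order.TTheory GRing.Theory Num.Theory.
Import numFieldNormedType.Exports.

Local Open Scope classical_set_scope.
Local Open Scope ring_scope.

(** * Independence *)

Section independence.
Context (d : measure_display) (T : measurableType d) (R : realType).
Variable P : probability T R.

(** With [C] fixed, both sides are finite measures in [A]. They agree on the pi-system [G], which
    contains the whole space, hence on the sigma-algebra it generates. *)
Lemma independent_of_pi_system (G : set (set T)) (C : set T) :
  G `<=` measurable -> setI_closed G -> G setT -> measurable C ->
  (forall A, G A -> P (A `&` C) = (P A * P C)%E) ->
  forall A, <<s G >> A -> P (A `&` C) = (P A * P C)%E.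
Proof.
move=> Gm GI GT mC GC A sA.
pose c := NngNum (fine_ge0 (measure_ge0 P C)).
have mscE B : mscale c P B = (P B * P C)%E.
  by rewrite /mscale /= fineK ?fin_num_measure// muleC.
rewrite -mscE.
apply: (@g_sigma_algebra_measure_unique _ _ _ G Gm _ (fun=> GT) _
  (mrestr P mC) (mscale c P)) => //.
- by apply/seteqP; split => // x _; exists 0%N.
- by move=> B GB; rewrite -[RHS]/(mscale c P B) mscE; exact: GC.
- move=> _; rewrite -[ltLHS]/(P (setT `&` C)) setTI.
  by rewrite (le_lt_trans (probability_le1 P mC))// ltry.
Qed.

(** Two passes of the previous lemma, one for each factor. *)
Lemma independent_pi_systems (G H : set (set T)) :
  G `<=` measurable -> setI_closed G -> G setT ->
  H `<=` measurable -> setI_closed H -> H setT ->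
  (forall A B, G A -> H B -> P (A `&` B) = (P A * P B)%E) ->
  forall A B, <<s G >> A -> <<s H >> B -> P (A `&` B) = (P A * P B)%E.
Proof.
move=> Gm GI GT Hm HI HT GH A B sA sB.
have sub K : K `<=` measurable -> <<s K >> `<=` @measurable _ T.
  by move=> Km; apply: smallest_sub => //; exact: sigma_algebra_measurable.
apply: (independent_of_pi_system Gm GI GT _ _ sA); first exact: sub sB.
move=> {sA} A' GA'; rewrite setIC muleC.
apply: (independent_of_pi_system Hm HI HT _ _ sB); first exact: Gm.
by move=> B' HB'; rewrite setIC muleC; exact: GH.
Qed.

(** Independence makes the joint law of [f] and [g] the product of their laws, and Tonelli's theorem
    splits the integral. *)
Lemma expectation_prod_independent (f g : T -> R) :
  measurable_fun setT f -> measurable_fun setT g ->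
  (forall x, 0 <= f x) -> (forall x, 0 <= g x) ->
  (forall A B, measurable A -> measurable B ->
     P (f @^-1` A `&` g @^-1` B) = (P (f @^-1` A) * P (g @^-1` B))%E) ->
  (\int[P]_x (f x * g x)%:E = \int[P]_x (f x)%:E * \int[P]_x (g x)%:E)%E.
Proof.
move=> mf mg f0 g0 fg.
pose GR := measurableTypeR R.
have mF : measurable_fun setT (f : T -> GR) := mf.
have mG : measurable_fun setT (g : T -> GR) := mg.
pose F : {mfun T >-> GR} := HB.pack f (isMeasurableFun.Build _ _ _ _ _ mF).
pose G : {mfun T >-> GR} := HB.pack g (isMeasurableFun.Build _ _ _ _ _ mG).
have mh : measurable_fun setT ((fun x => (f x, g x)) : T -> (GR * GR)%type).
  exact: (@measurable_fun_pair _ _ _ T GR GR).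
pose h : {mfun T >-> (GR * GR)%type} :=
  HB.pack (fun x : T => (f x, g x)) (isMeasurableFun.Build _ _ _ _ _ mh).
(* The absolute values make [k] nonnegative on the whole plane, as Tonelli requires; they change
   nothing on the range of [h]. *)
pose k (z : GR * GR) : \bar R := (`|z.1| * `|z.2|)%:E.
have mk : measurable_fun [set: (GR * GR)%type] k.
  apply/measurable_EFinP; apply: measurable_funM.
    exact: (measurableT_comp (@normr_measurable R _) measurable_fst).
  exact: (measurableT_comp (@normr_measurable R _) measurable_snd).
have k0 z : (0 <= k z)%E by rewrite lee_fin mulr_ge0.
have -> : (\int[P]_x (f x * g x)%:E = \int[distribution P h]_z k z)%E.
  rewrite ge0_integral_distribution//; apply: eq_integral => x _.
  by rewrite /k /= !ger0_norm.
rewrite (eq_measure_integral (distribution P F \x distribution P G)%E); last first.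
  by move=> A mA _; apply/esym; apply: product_measure_unique => // B C mB mC; exact: fg.
rewrite fubini_tonelli1//.
have EF : (\int[P]_x (f x)%:E = \int[distribution P F]_y `|y|%:E)%E.
  rewrite ge0_integral_distribution//=.
    by apply: eq_integral => x _; rewrite /= ger0_norm.
  by apply/measurable_EFinP.
have EG : (\int[P]_x (g x)%:E = \int[distribution P G]_y `|y|%:E)%E.
  rewrite ge0_integral_distribution//=.
    by apply: eq_integral => x _; rewrite /= ger0_norm.
  by apply/measurable_EFinP.
rewrite EF EG /fubini_F.
rewrite -ge0_integralZr//=; last first.
  by apply: integral_ge0.
  by apply/measurable_EFinP.
apply: eq_integral => x _; rewrite -ge0_integralZl//=.
by apply/measurable_EFinP.
Qed.

End independence.

(** * Sigma-algebras of index sets and centred sums of consecutive variables *)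

Section blocks.
Context (d : measure_display) (T : measurableType d) (R : realType).
Variables (P : probability T R) (X : nat -> {RV P >-> R}).

(* Generates the sigma-algebra of the variables with index in [J]. *)
Definition cylinder (J : {fset nat}) : set (set T) :=
  [set A | exists B : nat -> set R, (forall i, measurable (B i)) /\
     A = \bigcap_(i in [set` J]) (X i @^-1` B i)].

Lemma cylinder_measurable J : cylinder J `<=` measurable.
Proof.
move=> _ [B [mB ->]]; apply: bigcap_measurableType => i _.
exact: measurable_funPTI.
Qed.

Lemma cylinderI J : setI_closed (cylinder J).
Proof.
move=> _ _ [B [mB ->]] [C [mC ->]]; exists (fun i => B i `&` C i); split.
  by move=> i; exact: measurableI.
by rewrite -bigcapI.
Qed.

Lemma cylinderT J : cylinder J setT.
Proof.
exists (fun=> setT); split => //.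
by apply/seteqP; split.
Qed.

(** As [J] and [K] are disjoint, a cylinder over [J] meets one over [K] in a cylinder over the
    union, so the hypothesis gives the product rule on two pi-systems. *)
Lemma cylinder_independent (J K : {fset nat}) :
  mutually_independent X -> [disjoint J & K]%fset ->
  forall A B, <<s cylinder J >> A -> <<s cylinder K >> B ->
  P (A `&` B) = (P A * P B)%E.
Proof.
move=> hind JK; apply: independent_pi_systems;
  [exact: cylinder_measurable|exact: cylinderI|exact: cylinderT|
   exact: cylinder_measurable|exact: cylinderI|exact: cylinderT|].
move=> _ _ [B [mB ->]] [C [mC ->]].
pose D i := if i \in J then B i else C i.
have mD i : measurable (D i) by rewrite /D; case: ifP.
have KJ i : i \in K -> (i \in J) = false.
  by move=> iK; apply/negbTE; exact: (fdisjointP_sym JK).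
have -> : \bigcap_(i in [set` J]) (X i @^-1` B i) `&`
          \bigcap_(i in [set` K]) (X i @^-1` C i) =
          \bigcap_(i in [set` (J `|` K)%fset]) (X i @^-1` D i).
  apply/seteqP; split => [w [wB wC] i /=|w wD].
    rewrite in_fsetU => /orP[iJ|iK]; rewrite /D.
      by rewrite iJ; exact: wB.
    by rewrite KJ//; exact: wC.
  split => i /= iJ; have := wD i; rewrite /= in_fsetU iJ ?orbT => /(_ isT);
    by rewrite /D ?iJ ?KJ.
rewrite !hind//.
have /(perm_big _)-> : perm_eq (J `|` K)%fset (J ++ K).
  apply: uniq_perm; first exact: fset_uniq.
    rewrite cat_uniq !fset_uniq /= andbT; apply/hasPn => i iK.
    by apply/negbT/KJ.
  by move=> i; rewrite in_fsetU mem_cat.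
rewrite big_cat/=; congr (_ * _)%E; apply: eq_big_seq => i iJ.
  by rewrite /D iJ.
by rewrite /D KJ.
Qed.

Definition block (c : R) (k n : nat) (w : T) : R :=
  \sum_(i < n) (X (k + i)%N w - c).

Lemma measurable_block_cylinder (J : {fset nat}) (c : R) (k n : nat) :
  (forall i, (i < n)%N -> (k + i)%N \in J) ->
  measurable_fun setT (block c k n : g_sigma_algebraType (cylinder J) -> R).
Proof.
move=> kJ; apply: measurable_sum => i; apply: measurable_funB => //.
move=> _ B mB; rewrite setTI; apply: sub_sigma_algebra.
(* A cylinder that constrains the single coordinate [k + i]. *)
exists (fun j => if j == (k + i)%N then B else setT); split => [j|].
  by case: ifP.
apply/seteqP; split => [w wB j /=|w /(_ (k + i)%N)].
  by move=> _; case: eqP => // ->.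
by rewrite /= eqxx; apply; exact: kJ.
Qed.

End blocks.

(** * Moment estimates *)

Section moments.
Context (d : measure_display) (T : measurableType d) (R : realType).
Variable P : probability T R.

(** Lower bound: square [expR (x / 2) >= 1 + x / 2]. Upper bound: [expR x <= 1 / (1 - x)], and [(1 +
    x + 2 x^2) (1 - x) = 1 + x^2 (1 - 2 x) >= 1]. *)
Lemma expR_quadratic_bounds (x : R) : `|x| <= 2^-1 ->
  1 + x + x ^+ 2 / 4 <= expR x <= 1 + x + 2 * x ^+ 2.
Proof.
rewrite ler_norml => /andP[x1 x2]; apply/andP; split.
  have -> : expR x = expR (x / 2) ^+ 2 by rewrite expr2 -expRD -splitr.
  have h := expR_ge1Dx (x / 2).
  have -> : 1 + x + x ^+ 2 / 4 = (1 + x / 2) ^+ 2 by field.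
  by rewrite ler_sqr ?nnegrE ?expR_ge0//; lra.
rewrite -[x in expR x]opprK expRN -[leRHS]invrK lef_pV2 ?posrE ?expR_gt0//.
  apply: le_trans (expR_ge1Dx (- x)).
  rewrite -[leLHS]mul1r ler_pdivrMr; last nra.
  have := mulr_ge0 (sqr_ge0 x) (_ : 0 <= 1 - 2 * x); nra.
rewrite invr_gt0; nra.
Qed.

Lemma bounded_integrable (f : T -> R) (C : R) :
  measurable_fun setT f -> (forall x, `|f x| <= C) ->
  P.-integrable setT (EFin \o f).
Proof.
move=> mf fC; apply: measurable_bounded_integrable => //.
  by rewrite -ge0_fin_numE// fin_num_measure.
by exists C; split; [exact: num_real|move=> y Cy x _; exact: le_trans (fC x) (ltW Cy)].
Qed.

(** Integrating the quadratic bounds at [l * (Y w - c)] kills the linear term, because [c] is the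
    mean. *)
Lemma bounded_mgf_bounds (Y : T -> R) (a b c l : R) :
  measurable_fun setT Y -> (forall w, a <= Y w <= b) ->
  (\int[P]_w (Y w)%:E)%E = c%:E -> `|l| * (b - a) <= 2^-1 ->
  exists s, (\int[P]_w ((Y w - c) ^+ 2)%:E)%E = s%:E /\
  exists M, (\int[P]_w (expR (l * (Y w - c)))%:E)%E = M%:E /\
    1 + l ^+ 2 * s / 4 <= M <= 1 + 2 * (l ^+ 2 * s).
Proof.
move=> mY Yab Yc lab.
have iY : P.-integrable setT (EFin \o Y).
  apply: (@bounded_integrable _ (`|a| + `|b|)) => // w.
  have /andP[Ya Yb] := Yab w; have := ler_norm b; have := lerNnormlW (lexx `|a|).
  by have := normr_ge0 a; have := normr_ge0 b; rewrite ler_norml; lra.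
have iK (r : R) : P.-integrable setT (EFin \o (fun _ : T => r)).
  exact: (@bounded_integrable _ `|r|).
(* The mean lies between [a] and [b], so [Y w - c] is at most [b - a] in absolute value and the
   exponent at most 1/2. *)
have c_ab : a <= c <= b.
  rewrite -!lee_fin -Yc; apply/andP; split.
    have -> : a%:E = (\int[P]_w a%:E)%E.
      by rewrite integral_cst//= probability_setT mule1.
    by apply: (le_integral measurableT (iK a) iY) => w _; rewrite lee_fin; have /andP[] := Yab w.
  have -> : b%:E = (\int[P]_w b%:E)%E.
    by rewrite integral_cst//= probability_setT mule1.
  by apply: (le_integral measurableT iY (iK b)) => w _; rewrite lee_fin; have /andP[] := Yab w.
have mZ : measurable_fun setT (fun w => Y w - c) by exact: measurable_funB.
have ZC w : `|Y w - c| <= b - a by have := Yab w; rewrite ler_norml; lra.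
have lZ w : `|l * (Y w - c)| <= 2^-1.
  by rewrite normrM; apply: le_trans lab; rewrite ler_wpM2l.
have iZ : P.-integrable setT (EFin \o (fun w => Y w - c)).
  exact: (@bounded_integrable _ (b - a)).
have iZ2 : P.-integrable setT (EFin \o (fun w => (Y w - c) ^+ 2)).
  apply: (@bounded_integrable _ ((b - a) ^+ 2)) => [|w].
    exact: measurable_funX.
  by rewrite normrX ler_sqr ?nnegrE//; lra.
have iE : P.-integrable setT (EFin \o (fun w => expR (l * (Y w - c)))).
  apply: (@bounded_integrable _ (expR 2^-1)) => [|w].
    apply: measurableT_comp => //; exact: measurable_funM.
  rewrite ger0_norm ?expR_ge0// ler_expR (le_trans _ (lZ w))//.
  exact: ler_norm.
exists (\int[P]_w ((Y w - c) ^+ 2))%R; split.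
  by rewrite /Rintegral fineK//; exact: integrable_fin_num.
exists (\int[P]_w (expR (l * (Y w - c))))%R; split.
  by rewrite /Rintegral fineK//; exact: integrable_fin_num.
have Z0 : (\int[P]_w (Y w - c))%R = 0.
  rewrite RintegralB// Rintegral_cst//= probability_setT/= mulr1.
  by rewrite /Rintegral Yc/= subrr.
(* Serves both bounds, with [v = l^2 / 4] below and [v = 2 l^2] above. *)
have poly (u v : R) :
    P.-integrable setT (EFin \o (fun w => u * (Y w - c) + v * (Y w - c) ^+ 2 + 1)) /\
    (\int[P]_w (u * (Y w - c) + v * (Y w - c) ^+ 2 + 1))%R
    = v * (\int[P]_w ((Y w - c) ^+ 2))%R + 1.
  have iu : P.-integrable setT (EFin \o (fun w => u * (Y w - c))).
    exact: (integrableZl measurableT u iZ).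
  have iv : P.-integrable setT (EFin \o (fun w => v * (Y w - c) ^+ 2)).
    exact: (integrableZl measurableT v iZ2).
  have iuv : P.-integrable setT (EFin \o (fun w => u * (Y w - c) + v * (Y w - c) ^+ 2)).
    exact: (integrableD measurableT iu iv).
  split; first exact: (integrableD measurableT iuv (iK 1)).
  rewrite RintegralD// RintegralD// !RintegralZl// Z0 mulr0 add0r.
  by rewrite Rintegral_cst//= probability_setT/= mulr1.
apply/andP; split.
  have [i1 e1] := poly l (l ^+ 2 / 4).
  have -> : forall s, 1 + l ^+ 2 * s / 4 = (l ^+ 2 / 4) * s + 1 by move=> s; ring.
  rewrite -e1; apply: le_Rintegral => // w _.
  have /andP[+ _] := expR_quadratic_bounds (lZ w); rewrite exprMn; lra.
have [i1 e1] := poly l (2 * l ^+ 2).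
have -> : forall s, 1 + 2 * (l ^+ 2 * s) = (2 * l ^+ 2) * s + 1 by move=> s; ring.
rewrite -e1; apply: le_Rintegral => // w _.
have /andP[_] := expR_quadratic_bounds (lZ w); rewrite exprMn; lra.
Qed.

(** Clipping the variable to [[a, b]] changes it only on a null set, hence changes no integral, and
    turns the almost sure bounds into pointwise ones. *)
Lemma mgf_bounds (X : {RV P >-> R}) (a b l : R) :
  a < b -> {ae P, forall w, a <= X w <= b} -> `|l| * (b - a) <= 2^-1 ->
  'V_P[X] = (fine 'V_P[X])%:E /\
  exists M, (\int[P]_w (expR (l * (X w - fine 'E_P[X])))%:E)%E = M%:E /\
    1 + l ^+ 2 * fine 'V_P[X] / 4 <= M <= 1 + 2 * (l ^+ 2 * fine 'V_P[X]).
Proof.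
move=> ab Xab lab.
pose Y w := Num.max a (Num.min b (X w)).
have mY : measurable_fun setT Y.
  by apply: measurable_maxr => //; exact: measurable_minr.
have Yab w : a <= Y w <= b.
  by rewrite /Y le_max lexx /= ge_max ltW//= ge_min lexx.
have XY (f : R -> R) : measurable_fun setT f ->
    (\int[P]_w (f (X w))%:E = \int[P]_w (f (Y w))%:E)%E.
  move=> mf; apply: ae_eq_integral => //.
  - by apply/measurable_EFinP; apply: measurableT_comp.
  - by apply/measurable_EFinP; apply: measurableT_comp.
  apply: filterS Xab => w /andP[aX Xb] _; rewrite /Y.
  by rewrite (min_idPr Xb) (max_idPr aX).
have iY : P.-integrable setT (EFin \o Y).
  apply: (@bounded_integrable _ (`|a| + `|b|)) => // w.
  have /andP[Ya Yb] := Yab w; have := ler_norm b; have := lerNnormlW (lexx `|a|).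
  by have := normr_ge0 a; have := normr_ge0 b; rewrite ler_norml; lra.
have EX : (\int[P]_w (X w)%:E)%E = (fine 'E_P[X])%:E.
  rewrite unlock (XY id)// fineK//; exact: integrable_fin_num.
have EY : (\int[P]_w (Y w)%:E)%E = (fine 'E_P[X])%:E by rewrite -(XY id).
have [s [Es [M [EM HM]]]] := bounded_mgf_bounds mY Yab EY lab.
set c := fine 'E_P[X] in EX EY Es EM *.
have Vs : 'V_P[X] = s%:E.
  rewrite /variance unlock -Es -(XY (fun x => (x - c) ^+ 2)).
    by rewrite -/c unlock; apply: eq_integral => w _.
  by apply: measurable_funX; exact: measurable_funB.
rewrite Vs/=; split => //; exists M; split => //.
rewrite (XY (fun x => expR (l * (x - c))))//.
apply: measurableT_comp => //; apply: measurable_funM => //.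
exact: measurable_funB.
Qed.

(** Integrating [W <= t + L 1_E + W^2 / L] with [L = 2 B / t] gives [2 t <= t + L P(E) + t / 2], so
    [P(E) >= t / (2 L) = t^2 / (4 B)]. *)
Lemma paley_zygmund (W : T -> R) (t B : R) :
  measurable_fun setT W -> (forall w, 0 <= W w) -> 0 < t -> 0 < B ->
  ((2 * t)%:E <= \int[P]_w (W w)%:E)%E ->
  (\int[P]_w (W w ^+ 2)%:E <= B%:E)%E ->
  ((t ^+ 2 / (4 * B))%:E <= P [set w | (t <= W w)%R])%E.
Proof.
move=> mW W0 t0 B0 EW EW2; set E := [set w | _].
have mE : measurable E.
  rewrite -[E]setTI (_ : E = W @^-1` `[t, +oo[).
    by apply: mW => //; exact: measurable_itv.
  by apply/seteqP; split => w; rewrite /= in_itv/= andbT.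
pose L := 2 * B / t.
have L0 : 0 < L by rewrite divr_gt0// mulr_gt0.
(* If [t <= W w] then [W w <= L] or [W w <= W w ^+ 2 / L]. *)
have WE w : W w <= t + L * \1_E w + L^-1 * W w ^+ 2.
  have W2 : 0 <= L^-1 * W w ^+ 2 by rewrite mulr_ge0 ?invr_ge0 ?sqr_ge0 ?ltW.
  rewrite indicE; have [wt|tw] := ltP (W w) t.
    rewrite memNset ?mulr0 ?addr0; last by rewrite /E /= leNgt wt.
    by rewrite (le_trans (ltW wt))// lerDl.
  rewrite mem_set// mulr1; have [wL|Lw] := leP (W w) L; first lra.
  have : W w <= L^-1 * W w ^+ 2; last by lra.
  by rewrite mulrC ler_pdivlMr// expr2 ler_wpM2l// ltW.
have : (\int[P]_w (W w)%:E <= t%:E + L%:E * P E + L^-1%:E * B%:E)%E.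
  apply: (@le_trans _ _ (\int[P]_w (t + L * \1_E w + L^-1 * W w ^+ 2)%:E)%E).
    apply: ge0_le_integral => //.
    - by move=> w _; rewrite lee_fin.
    - exact/measurable_EFinP.
    - apply/measurable_EFinP; apply: measurable_funD.
        by apply: measurable_funD => //; apply: measurable_funM.
      by apply: measurable_funM => //; exact: measurable_funX.
    - by move=> w _; rewrite lee_fin.
  under eq_integral do rewrite EFinD.
  rewrite ge0_integralD//=; first last.
  - apply/measurable_EFinP.
    by apply: measurable_funM => //; exact: measurable_funX.
  - by move=> w _; rewrite lee_fin mulr_ge0 ?invr_ge0 ?sqr_ge0 ?(ltW L0).
  - apply/measurable_EFinP.
    by apply: measurable_funD => //; apply: measurable_funM.
  - by move=> w _; rewrite lee_fin addr_ge0 ?(ltW t0)// mulr_ge0 ?(ltW L0) ?indicE.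
  under eq_integral do rewrite EFinD.
  rewrite ge0_integralD//=; first last.
  - by apply/measurable_EFinP; apply: measurable_funM.
  - by move=> w _; rewrite lee_fin mulr_ge0 ?(ltW L0) ?indicE.
  - by move=> w _; rewrite lee_fin ltW.
  rewrite integral_cst//= probability_setT mule1.
  under eq_integral do rewrite EFinM.
  rewrite ge0_integralZl_EFin ?(ltW L0)//; last exact/measurable_EFinP.
  under [X in (_ + X)%E]eq_integral do rewrite EFinM.
  rewrite ge0_integralZl_EFin ?invr_ge0 ?(ltW L0)//; first last.
    by apply/measurable_EFinP; exact: measurable_funX.
    by move=> w _; rewrite lee_fin sqr_ge0.
  rewrite integral_indic// setIT; apply: leeD => //.
  by apply: lee_wpmul2l => //; rewrite lee_fin invr_ge0 ltW.
move=> /(le_trans EW).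
have <- : (fine (P E))%:E = P E by rewrite fineK// fin_num_measure.
rewrite -!EFinM -!EFinD !lee_fin => H.
rewrite ler_pdivrMr ?mulr_gt0//.
have LB : L^-1 * B = t / 2.
  by rewrite /L; field; rewrite !gt_eqF.
have LL : L * fine (P E) * t = 2 * B * fine (P E).
  by rewrite /L; field; rewrite !gt_eqF.
move: H; rewrite LB => H.
have : t / 2 * t <= L * fine (P E) * t by rewrite ler_pM2r//; lra.
rewrite LL expr2; lra.
Qed.

End moments.

(** * A quantitative first Borel-Cantelli lemma *)

Section borel_cantelli.
Context (d : measure_display) (T : measurableType d) (R : realType).
Variable P : probability T R.

(** The bounds telescope, since [1 / ((n + 1) (n + 2)) = 1 / (n + 1) - 1 / (n + 2)], so the
    probabilities are summable. *)
Lemma borel_cantelli_inv_sq (F : (set T)^nat) (C : R) (N : nat) :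
  (forall n, measurable (F n)) -> 0 <= C ->
  (forall n, (N <= n)%N -> (P (F n) <= (C / (n.+1%:R * n.+2%:R))%:E)%E) ->
  {ae P, forall w, exists M, forall n, (M <= n)%N -> ~ F n w}.
Proof.
move=> mF C0 PF.
(* The added term makes the bound at least 1 for [n < N], where nothing is assumed, so that it holds
   for every [n]. *)
pose D := C + N.+1%:R * N.+2%:R.
have D0 : 0 <= D by rewrite addr_ge0// mulr_ge0.
have PD n : (P (F n) <= (D / n.+1%:R - D / n.+2%:R)%:E)%E.
  have -> : D / n.+1%:R - D / n.+2%:R = D / (n.+1%:R * n.+2%:R).
    have -> : n.+2%:R = n.+1%:R + 1 :> R by rewrite natr1.
    have : 0 < n.+1%:R :> R by [].
    by move: n.+1%:R => z z0; field; apply/andP; split; rewrite gt_eqF//; lra.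
  have nn : 0 < n.+1%:R * n.+2%:R :> R by rewrite mulr_gt0.
  have [/PF Pn|nN] := leqP N n.
    apply: le_trans Pn _; rewrite lee_fin ler_pM2r ?invr_gt0// lerDl.
    by rewrite mulr_ge0.
  apply: le_trans (probability_le1 P (mF n)) _.
  rewrite lee_fin ler_pdivlMr// mul1r (@le_trans _ _ (N.+1%:R * N.+2%:R))//.
    by rewrite ler_pM// ler_nat ltnS ltnW.
  by rewrite lerDr.
have : P (lim_sup_set F) = 0%E.
  apply: lim_sup_set_cvg0 => //.
  apply: (@le_lt_trans _ _ D%:E); last exact: ltry.
  apply: lime_le; first exact: is_cvg_nneseries.
  apply: nearW => n.
  apply: (@le_trans _ _ (\sum_(0 <= i < n) (D / i.+1%:R - D / i.+2%:R)%:E)%E).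
    by apply: lee_sum => i _; exact: PD.
  rewrite sumEFin lee_fin.
  rewrite (@telescope_sumr_eq _ 0%N n (fun i => - (D / i.+1%:R)) _ (leq0n n)); last first.
    by move=> i _; rewrite opprK addrC.
  by rewrite opprK divr1 gerDr oppr_le0 divr_ge0.
move=> P0; exists (lim_sup_set F); split => //.
  apply: bigcap_measurable => // k _; exact: bigcup_measurable.
move=> w /= /forallNP nM k _.
have /existsNP[n /not_implyP[kn Fn]] := nM k.
by exists n => //; exact: contrapT.
Qed.

End borel_cantelli.

(** * Tails of block sums *)

Section block_estimates.
Context (d : measure_display) (T : measurableType d) (R : realType).
Variables (P : probability T R) (X : nat -> {RV P >-> R}).

Lemma measurable_block (c : R) (k n : nat) :
  measurable_fun setT (block X c k n).
Proof. by apply: measurable_sum => i; exact: measurable_funB. Qed.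

Lemma block_cat (c : R) (k n m : nat) (w : T) :
  block X c k (n + m) w = block X c k n w + block X c (k + n) m w.
Proof.
rewrite /block big_split_ord; congr (_ + _).
by apply: eq_bigr => i _; rewrite /= addnA.
Qed.

Lemma block1 (c : R) (k : nat) (w : T) : block X c k 1 w = X k w - c.
Proof. by rewrite /block big_ord1 addn0. Qed.

Lemma block_preimage_cylinder (J : {fset nat}) (c : R) (k n : nat) (A : set R) :
  (forall i, (i < n)%N -> (k + i)%N \in J) -> measurable A ->
  <<s cylinder X J >> (block X c k n @^-1` A).
Proof.
move=> kJ mA; have := measurable_block_cylinder (X := X) c kJ.
by move=> /(_ measurableT A mA); rewrite setTI.
Qed.

Definition fset_range (k n : nat) : {fset nat} := [fset i in iota k n]%fset.

Lemma in_fset_range (k n i : nat) :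
  (i \in fset_range k n) = (k <= i < k + n)%N.
Proof. by rewrite !inE /= mem_iota. Qed.

Lemma fset_range_disjoint (k n l m : nat) : (k + n <= l)%N ->
  [disjoint fset_range k n & fset_range l m]%fset.
Proof.
move=> knl; apply/fdisjointP => i; rewrite !in_fset_range => /andP[_ ikn].
by rewrite negb_and -ltnNge (leq_trans ikn knl).
Qed.

Hypotheses (hind : mutually_independent X) (hid : identically_distributed X).

Lemma mgf_identically_distributed (c l : R) (i : nat) :
  (\int[P]_w (expR (l * (X i w - c)))%:E
   = \int[P]_w (expR (l * (X 0%N w - c)))%:E)%E.
Proof.
pose f (x : R) := (expR (l * (x - c)))%:E.
have mf : measurable_fun setT f.
  apply/measurable_EFinP/measurableT_comp => //.
  by apply: measurable_funM => //; exact: measurable_funB.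
have f0 x : (0 <= f x)%E by rewrite lee_fin expR_ge0.
rewrite -(@ge0_integral_distribution _ _ _ _ _ P (X i) f)//.
rewrite -(@ge0_integral_distribution _ _ _ _ _ P (X 0%N) f)//.
by apply: eq_measure_integral => A mA _; exact: hid.
Qed.

(** Induction on [n]: the first [n] variables and the next one have disjoint index ranges, so the
    expectation of the product of their exponentials factors. *)
Lemma mgf_block (c l M : R) (k n : nat) :
  (\int[P]_w (expR (l * (X 0%N w - c)))%:E)%E = M%:E ->
  (\int[P]_w (expR (l * block X c k n w))%:E)%E = (M ^+ n)%:E.
Proof.
move=> HM; elim: n => [|n IHn].
  under eq_integral do rewrite /block big_ord0 mulr0 expR0.
  by rewrite integral_cst//= probability_setT mule1.
have mg : measurable_fun [set: R] (fun x : R => expR (l * x)).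
  by apply: measurableT_comp => //; exact: measurable_funM.
have me j m : measurable_fun setT (fun w => expR (l * block X c j m w)).
  by apply: (measurableT_comp mg); exact: measurable_block.
under eq_integral do rewrite -addn1 block_cat mulrDr expRD.
rewrite expectation_prod_independent//.
  under [X in (_ * X)%E]eq_integral do rewrite block1.
  by rewrite IHn mgf_identically_distributed HM exprSr EFinM.
move=> A B mA mB.
apply: (cylinder_independent hind (J := fset_range k n) (K := fset_range (k + n) 1)).
- exact: fset_range_disjoint.
- apply: (@block_preimage_cylinder _ c k n ((fun x => expR (l * x)) @^-1` A)).
    by move=> i i_n; rewrite in_fset_range leq_addr ltn_add2l.
  by rewrite -[_ @^-1` _]setTI; exact: mg.
- apply: (@block_preimage_cylinder _ c (k + n) 1 ((fun x => expR (l * x)) @^-1` B)).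
    by move=> i i_n; rewrite in_fset_range leq_addr ltn_add2l.
  by rewrite -[_ @^-1` _]setTI; exact: mg.
Qed.

Variables (c s C : R).
Hypotheses (s_gt0 : 0 < s) (C_gt0 : 0 < C).
Hypothesis mgf_bound : forall l : R, `|l| * C <= 2^-1 ->
  exists M, (\int[P]_w (expR (l * (X 0%N w - c)))%:E)%E = M%:E /\
    1 + l ^+ 2 * s / 4 <= M <= 1 + 2 * (l ^+ 2 * s).

(** Here [c], [s] and [C] stand for the mean, the variance and [b - a]. The side conditions give
    [|u / sqrt n| C <= 1/2] and [y <= 4] for [y = u^2 s / n]. Then [(1 + 2 y)^n <= exp(2 y n)], and
    [exp(y / 8) <= 1 + y / 8 + 2 (y / 8)^2 <= 1 + y / 4]. *)
Lemma mgf_block_bounds (u : R) (k n : nat) : (0 < n)%N ->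
  2 * `|u| * C <= Num.sqrt n%:R -> u ^+ 2 * s <= 4 * n%:R ->
  exists M, [/\
    (\int[P]_w (expR (u / Num.sqrt n%:R * block X c k n w))%:E)%E = M%:E,
    expR (u ^+ 2 * s / 8) <= M & M <= expR (2 * (u ^+ 2 * s))].
Proof.
move=> n0 uC us; set r := Num.sqrt n%:R in uC *.
have nR : 0 < n%:R :> R by rewrite ltr0n.
have r0 : 0 < r by rewrite sqrtr_gt0.
have r2 : r ^+ 2 = n%:R by rewrite sqr_sqrtr// ltW.
have [|M [EM /andP[M1 M2]]] := @mgf_bound (u / r).
  rewrite normrM normfV (gtr0_norm r0) mulrAC ler_pdivrMr//; lra.
have lu : (u / r) ^+ 2 * s = u ^+ 2 * s / n%:R.
  by rewrite exprMn exprVn r2 mulrAC.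
rewrite lu in M1 M2; set y := u ^+ 2 * s / n%:R in M1 M2.
have yn : y * n%:R = u ^+ 2 * s by rewrite divfK// gt_eqF.
have y0 : 0 <= y by rewrite /y divr_ge0 ?(ltW nR)// mulr_ge0 ?sqr_ge0// ltW.
have y4 : y <= 4 by rewrite /y ler_pdivrMr.
have M0 : 0 <= M by lra.
exists (M ^+ n); split.
- exact: mgf_block.
- have -> : u ^+ 2 * s / 8 = n%:R * (y / 8) by rewrite -yn; ring.
  rewrite expRM_natl lerXn2r ?nnegrE ?expR_ge0//.
  have y8 : `|y / 8| <= 2^-1 by rewrite ger0_norm; lra.
  have /andP[_] := expR_quadratic_bounds y8.
  nra.
- have -> : 2 * (u ^+ 2 * s) = n%:R * (2 * y) by rewrite -yn; ring.
  rewrite expRM_natl lerXn2r ?nnegrE ?expR_ge0//.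
  exact: le_trans M2 (expR_ge1Dx _).
Qed.

(** Paley-Zygmund for [W = exp(u D / sqrt n)], with [D] the block sum and threshold [exp(u A)]. The
    second moment of [W] is the same exponential moment at [2 u], so [q] depends on neither [k] nor
    [n]. *)
Lemma block_lower_tail (A : R) : 0 <= A ->
  exists q N, 0 < q /\ forall k n, (N <= n)%N ->
    (q%:E <= P [set w | (A * Num.sqrt n%:R <= block X c k n w)%R])%E.
Proof.
move=> A0.
(* [u] is so large that [expR (u ^+ 2 * s / 8)], which bounds the mean of [W]
   below, exceeds twice the threshold [t]. *)
pose u := 1 + 8 * (A + 1) / s.
have u1 : 1 <= u by rewrite /u lerDl divr_ge0 ?(ltW s_gt0)// mulr_ge0// addr_ge0.
have us : 8 * (A + 1) <= u * s.
  have -> : u * s = s + 8 * (A + 1) by rewrite /u; field; rewrite gt_eqF.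
  by rewrite lerDr ltW.
pose t := expR (u * A); pose B := expR (2 * ((2 * u) ^+ 2 * s)).
have t0 : 0 < t by exact: expR_gt0.
have B0 : 0 < B by exact: expR_gt0.
(* For [n >= K] the side conditions of [mgf_block_bounds] hold at both [u] and [2 u]; each summand
   handles one of them. *)
pose K := (4 * u * C) ^+ 2 + (2 * u) ^+ 2 * s.
have K1 : 0 <= (4 * u * C) ^+ 2 by exact: sqr_ge0.
have K2 : 0 <= (2 * u) ^+ 2 * s by rewrite mulr_ge0 ?sqr_ge0// ltW.
exists (t ^+ 2 / (4 * B)), (Num.bound K).+1; split.
  by rewrite divr_gt0 ?exprn_gt0 ?mulr_gt0.
move=> k n Nn; have n0 : (0 < n)%N by exact: leq_ltn_trans Nn.
have nR : 0 < n%:R :> R by rewrite ltr0n.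
have Kn : K <= n%:R.
  have := archi_boundP (addr_ge0 K1 K2) => /ltW/le_trans; apply.
  by rewrite ler_nat ltnW.
have r0 : 0 < Num.sqrt n%:R :> R by rewrite sqrtr_gt0.
have uC : 4 * u * C <= Num.sqrt n%:R.
  have uC0 : 0 <= 4 * u * C by rewrite !mulr_ge0 ?(ltW C_gt0)//; lra.
  rewrite -(ger0_norm uC0) -sqrtr_sqr ler_sqrt; last exact: ltW.
  by rewrite (le_trans _ Kn)// lerDl.
have nu : `|u| = u by rewrite ger0_norm//; lra.
have n2u : `|2 * u| = 2 * u by rewrite ger0_norm//; lra.
have [||M1 [E1 L1 _]] := @mgf_block_bounds u k n n0.
- rewrite nu (le_trans _ uC)// ler_pM2r//; lra.
- have : (2 * u) ^+ 2 * s <= n%:R by rewrite (le_trans _ Kn)// lerDr.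
  rewrite exprMn; nra.
have [||M2 [E2 _ L2]] := @mgf_block_bounds (2 * u) k n n0.
- rewrite n2u (le_trans _ uC)// ler_pM2r//; lra.
- have : (2 * u) ^+ 2 * s <= n%:R by rewrite (le_trans _ Kn)// lerDr.
  lra.
pose W w := expR (u / Num.sqrt n%:R * block X c k n w).
have -> : [set w | A * Num.sqrt n%:R <= block X c k n w] = [set w | t <= W w].
  apply/seteqP; split => w /=; rewrite /t /W ler_expR mulrAC -mulrA;
    by rewrite ler_pM2l ?ler_pdivlMr//; lra.
apply: paley_zygmund => //.
- apply: measurableT_comp => //; apply: measurable_funM => //.
  exact: measurable_block.
- by move=> w; exact: expR_ge0.
- rewrite E1 lee_fin (le_trans _ L1)//.
  (* The factor 2 is absorbed by [exp(1)]: [1 + u A <= u (A + 1) <= u^2 s / 8]. *)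
  have : 2 <= expR 1 :> R by have := expR_ge1Dx (1 : R); lra.
  move=> e2; apply: (@le_trans _ _ (expR 1 * t)); first by rewrite ler_pM2r.
  rewrite /t -expRD ler_expR.
  have : u * (8 * (A + 1)) <= u * (u * s) by rewrite ler_pM2l//; lra.
  rewrite expr2; nra.
- rewrite (_ : (\int[P]_w (W w ^+ 2)%:E)%E = M2%:E); first by rewrite lee_fin.
  rewrite -E2; apply: eq_integral => w _; congr EFin.
  by rewrite /W expr2 -expRD; congr expR; ring.
Qed.

(** Chernoff's bound at parameter [1 / sqrt n], for the block sum and for its opposite; the two
    tails add up to [K = 2 exp(2 s)]. *)
Lemma block_upper_tail : exists K N, 0 <= K /\ forall n, (N <= n)%N -> forall x : R,
  (P [set w | (x * Num.sqrt n%:R <= `|block X c 0 n w|)%R]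
     <= (K * expR (- x))%:E)%E.
Proof.
pose K := (2 * C) ^+ 2 + s.
have K1 : 0 <= (2 * C) ^+ 2 by exact: sqr_ge0.
exists (expR (2 * s) + expR (2 * s)), (Num.bound K).+1.
split; first by rewrite addr_ge0 ?expR_ge0.
move=> n Nn x; have n0 : (0 < n)%N by exact: leq_ltn_trans Nn.
have nR : 0 < n%:R :> R by rewrite ltr0n.
have Kn : K <= n%:R.
  have := archi_boundP (addr_ge0 K1 (ltW s_gt0)) => /ltW/le_trans; apply.
  by rewrite ler_nat ltnW.
have r0 : 0 < Num.sqrt n%:R :> R by rewrite sqrtr_gt0.
have C2 : 2 * C <= Num.sqrt n%:R.
  have C20 : 0 <= 2 * C by rewrite mulr_ge0 ?(ltW C_gt0).
  rewrite -(ger0_norm C20) -sqrtr_sqr ler_sqrt; last exact: ltW.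
  by rewrite (le_trans _ Kn)// lerDl ltW.
have tail (u : R) : `|u| = 1 ->
    (P [set w | (x * Num.sqrt n%:R <= u * block X c 0 n w)%R]
      <= (expR (2 * s) * expR (- x))%:E)%E.
  move=> u1; have u2 : u ^+ 2 = 1 by rewrite -real_normK ?num_real// u1 expr1n.
  have [||M [EM _ LM]] := @mgf_block_bounds u 0 n n0.
  - by rewrite u1 mulr1.
  - by rewrite u2 mul1r; rewrite (le_trans (_ : s <= K)) ?lerDr//; lra.
  have mY : measurable_fun setT (fun w => u * block X c 0 n w).
    by apply: measurable_funM => //; exact: measurable_block.
  pose Y : {RV P >-> R} := HB.pack (fun w => u * block X c 0 n w)
    (isMeasurableFun.Build _ _ _ _ _ mY).
  have ri : 0 < (Num.sqrt n%:R)^-1 :> R by rewrite invr_gt0.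
  apply: le_trans (chernoff Y (x * Num.sqrt n%:R) ri) _.
  rewrite mulrCA mulVf ?gt_eqF// mulr1 EFinM lee_wpmul2r ?lee_fin ?expR_ge0//.
  rewrite /mmt_gen_fun unlock.
  rewrite (_ : (\int[P]_w _)%E = M%:E); first by rewrite lee_fin; move: LM; rewrite u2 mul1r.
  rewrite -EM; apply: eq_integral => w _ /=; congr (expR _)%:E; ring.
have mE (u : R) : measurable [set w | x * Num.sqrt n%:R <= u * block X c 0 n w].
  rewrite -[X in measurable X]setTI.
  have -> : [set w | x * Num.sqrt n%:R <= u * block X c 0 n w] =
      (fun w => u * block X c 0 n w) @^-1` `[x * Num.sqrt n%:R, +oo[.
    by apply/seteqP; split => w; rewrite /= in_itv/= andbT.
  suff : measurable_fun setT (fun w => u * block X c 0 n w).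
    by apply => //; exact: measurable_itv.
  by apply: measurable_funM => //; exact: measurable_block.
apply: (@le_trans _ _ (P ([set w | x * Num.sqrt n%:R <= 1 * block X c 0 n w]
    `|` [set w | x * Num.sqrt n%:R <= -1 * block X c 0 n w])%R)).
  apply: le_measure; rewrite ?inE.
  - rewrite -[X in measurable X]setTI.
    have -> : [set w | x * Num.sqrt n%:R <= `|block X c 0 n w|] =
        (fun w => `|block X c 0 n w|) @^-1` `[x * Num.sqrt n%:R, +oo[.
      by apply/seteqP; split => w; rewrite /= in_itv/= andbT.
    suff : measurable_fun setT (fun w => `|block X c 0 n w|).
      by apply => //; exact: measurable_itv.
    by apply: measurableT_comp => //; exact: measurable_block.
  - exact: measurableU.
  - by move=> w /=; rewrite ler_normr mul1r mulN1r => /orP.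
rewrite mulrDl EFinD.
apply: le_trans (measureU2 _ (mE 1) (mE (-1))) _.
by apply: leeD; apply: tail; rewrite ?normrN1 ?normr1.
Qed.

(** With [e = 1/2 - 1/t > 0] one has [n^(1 - 1/t) = n^e sqrt n], so the upper tail applies with
    [x = n^e], and [exp(- n^e)] is [O(1 / n^2)]. *)
Lemma block_upper_ae (t : R) : 2 < t -> {ae P, forall w, exists M, forall n,
  (M <= n)%N -> `|block X c 0 n.+1 w| < n.+1%:R `^ (1 - t^-1)}.
Proof.
move=> t2; have [K [N [K0 PK]]] := block_upper_tail.
pose e := 2^-1 - t^-1.
have e0 : 0 < e by rewrite subr_gt0 ltf_pV2 ?posrE//; lra.
(* Chosen so that [y = (n + 1)^e] satisfies [y^(m + 1) >= (n + 1)^2]; then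
   [exp(y) >= y^(m + 1) / (m + 1)!] gives the quadratic decay. *)
pose m := Num.bound (2 / e).
have me : 2 <= e * m.+1%:R.
  rewrite mulrC -ler_pdivrMr//.
  have /archi_boundP/ltW/le_trans : 0 <= 2 / e by rewrite divr_ge0 ?(ltW e0).
  by apply; rewrite ler_nat.
pose F n := [set w | n.+1%:R `^ e * Num.sqrt n.+1%:R <= `|block X c 0 n.+1 w|].
have mF n : measurable (F n).
  rewrite -[F n]setTI.
  have -> : F n = (fun w => `|block X c 0 n.+1 w|)
      @^-1` `[n.+1%:R `^ e * Num.sqrt n.+1%:R, +oo[.
    by apply/seteqP; split => w; rewrite /F /= in_itv/= andbT.
  suff : measurable_fun setT (fun w => `|block X c 0 n.+1 w|).
    by apply => //; exact: measurable_itv.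
  by apply: measurableT_comp => //; exact: measurable_block.
have C0 : 0 <= 2 * (K * m.+1`!%:R) :> R by rewrite !mulr_ge0.
have PF n : (N <= n)%N ->
    (P (F n) <= (2 * (K * m.+1`!%:R) / (n.+1%:R * n.+2%:R))%:E)%E.
  move=> Nn; apply: le_trans (PK _ (leqW Nn) _) _.
  rewrite lee_fin.
  have n1 : 1 <= n.+1%:R :> R by rewrite ler1n.
  have n0 : 0 < n.+1%:R :> R by rewrite ltr0n.
  set y := n.+1%:R `^ e.
  have y0 : 0 < y by exact: powR_gt0.
  have ym : n.+1%:R ^+ 2 <= y ^+ m.+1.
    rewrite -(powR_mulrn _ (ltW n0)) -(powR_mulrn _ (ltW y0)) -powRrM.
    by rewrite ler_powR.
  have f0 : 0 < m.+1`!%:R :> R by rewrite ltr0n fact_gt0.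
  have ey : n.+1%:R ^+ 2 / m.+1`!%:R <= expR y.
    apply: le_trans (expR_ge1Dxn m (ltW y0)).
    rewrite (@le_trans _ _ (y ^+ m.+1 / m.+1`!%:R)) ?lerDr//.
    by rewrite ler_pM2r// invr_gt0.
  have n22 : n.+1%:R * n.+2%:R <= 2 * n.+1%:R ^+ 2 :> R.
    rewrite -[n.+2%:R]natr1; move: n1; rewrite expr2; nra.
  rewrite ler_pdivlMr ?mulr_gt0// expRN mulrAC ler_pdivrMr ?expR_gt0//.
  rewrite [2 * _]mulrCA -!mulrA ler_wpM2l//.
  apply: le_trans n22 _; rewrite ler_pM2l// mulrC -ler_pdivrMr//.
apply: filterS (borel_cantelli_inv_sq mF C0 PF) => w [M HM]; exists M => n Mn.
rewrite ltNge; apply/negP => le; apply: (HM n Mn); rewrite /F /=.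
rewrite -powR12_sqrt// -powRD; last by apply/implyP => _; rewrite gt_eqF.
by rewrite (_ : e + 2^-1 = 1 - t^-1)// /e; lra.
Qed.

(** The blocks occupy the disjoint index ranges [[4^j, 4^(j + 1))]. By independence [m] consecutive
    events hold together with probability at most [(1 - q)^m], which tends to 0. *)
Lemma block_lower_ae : {ae P, forall w, ~ exists M, forall j, (M <= j)%N ->
  block X c (4 ^ j) (3 * 4 ^ j) w < 3 * 2 ^+ j}.
Proof.
(* The constant 2 suffices because [3 * 2^j <= 2 sqrt(3 * 4^j)]. *)
have [q [N [q0 PN]]] := block_lower_tail (ler0n R 2).
pose G j := [set w | block X c (4 ^ j) (3 * 4 ^ j) w < 3 * 2 ^+ j].
have GE j : G j = block X c (4 ^ j) (3 * 4 ^ j) @^-1` `]-oo, 3 * 2 ^+ j[.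
  by apply/seteqP; split => w; rewrite /G /= in_itv.
have mG j : measurable (G j).
  by rewrite GE -[X in measurable X]setTI; apply: measurable_block.
have PG j : (N <= j)%N -> (P (G j) <= (1 - q)%:E)%E.
  move=> Nj; have jn : (N <= 3 * 4 ^ j)%N.
    rewrite (leq_trans Nj)// (leq_trans (ltnW (ltn_expl j (isT : (1 < 4)%N))))//.
    by rewrite leq_pmull.
  rewrite -[G j]setCK probability_setC; last exact: measurableC.
  rewrite EFinB leeB//; apply: le_trans (PN (4 ^ j)%N _ jn) _.
  apply: le_measure; rewrite ?inE; first 1 last.
  - exact: measurableC.
  - move=> w; rewrite /G /= => /(le_trans _) H; apply/negP; rewrite -leNgt; apply: H.
    rewrite -ler_pdivrMl//.
    have x0 : 0 <= 2^-1 * (3 * 2 ^+ j) :> R by rewrite !mulr_ge0 ?exprn_ge0.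
    rewrite -(ger0_norm x0) -sqrtr_sqr ler_sqrt//.
    rewrite !exprMn natrM natrX exprAC (_ : 2 ^+ 2 = 4 :> R); last by rewrite -natrX.
    have : 0 <= 4 ^+ j :> R by rewrite exprn_ge0.
    lra.
  - rewrite -[X in measurable X]setTI.
    have -> : [set w | 2 * Num.sqrt (3 * 4 ^ j)%:R
          <= block X c (4 ^ j) (3 * 4 ^ j) w] =
        block X c (4 ^ j) (3 * 4 ^ j)
          @^-1` `[2 * Num.sqrt (3 * 4 ^ j)%:R, +oo[.
      by apply/seteqP; split => w; rewrite /= in_itv/= andbT.
    by apply: measurable_block.
have q1 : q <= 1.
  have := PG N (leqnn N) => /(le_trans (measure_ge0 P _)).
  by rewrite lee_fin subr_ge0.
pose H j0 m := \bigcap_(i in `I_m) G (j0 + i)%N.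
have mH j0 m : measurable (H j0 m) by exact: bigcap_measurableType.
(* These events involve only indices below [4^(j0 + m)], where the next block starts. *)
have sH j0 m : <<s cylinder X (fset_range 0 (4 ^ (j0 + m))) >> (H j0 m).
  pose TT := g_sigma_algebraType (cylinder X (fset_range 0 (4 ^ (j0 + m)))).
  apply: (@bigcap_measurableType _ TT) => i /= im.
  rewrite GE; apply: block_preimage_cylinder => // l l3.
  rewrite in_fset_range /= add0n.
  apply: (@leq_trans (4 ^ (j0 + i) + 3 * 4 ^ (j0 + i))).
    by rewrite ltn_add2l.
  rewrite -mulSn -expnS leq_exp2l// -addnS leq_add2l//.
have PH j0 m : (N <= j0)%N -> (P (H j0 m) <= ((1 - q) ^+ m)%:E)%E.
  move=> Nj; elim: m => [|m IHm]; first by rewrite expr0 probability_le1.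
  have -> : H j0 m.+1 = H j0 m `&` G (j0 + m)%N.
    by rewrite /H IIS bigcap_setU bigcap_set1.
  have dis : [disjoint fset_range 0 (4 ^ (j0 + m)) &
      fset_range (4 ^ (j0 + m)) (3 * 4 ^ (j0 + m))]%fset.
    exact: fset_range_disjoint.
  rewrite (cylinder_independent hind dis (sH j0 m)).
    by rewrite exprSr EFinM lee_pmul// PG// (leq_trans Nj)// leq_addr.
  rewrite GE; apply: block_preimage_cylinder => // l l3.
  by rewrite in_fset_range leq_addr ltn_add2l.
have P0 j0 : (N <= j0)%N -> P (\bigcap_i G (j0 + i)%N) = 0%E.
  move=> Nj.
  have mI : measurable (\bigcap_i G (j0 + i)%N) by exact: bigcapT_measurable.
  apply/eqP; rewrite eq_le measure_ge0 andbT.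
  have : ((1 - q) ^+ m)%:E @[m --> \oo] --> (0%:E : \bar R).
    apply: cvg_EFin; first exact: nearW.
    by apply: cvg_expr; rewrite ger0_norm; lra.
  apply: cvge_ge; apply: nearW => m.
  apply: le_trans (PH j0 m Nj); apply: le_measure; rewrite ?inE//.
  by move=> w Gw i _; exact: Gw.
(* The bound [1 - q] is valid only from [N] on; if all events from [M] on hold, so do all those from
   [N + M] on. *)
exists (\bigcup_j0 \bigcap_i G (N + j0 + i)%N); split.
- by apply: bigcupT_measurable => j0; exact: bigcapT_measurable.
- apply/negligibleP.
    by apply: bigcupT_measurable => j0; exact: bigcapT_measurable.
  apply: negligible_bigcup => j0; apply/negligibleP.
    exact: bigcapT_measurable.
  by apply: P0; exact: leq_addr.
- move=> w /= /contrapT[M HM]; exists M => // i _.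
  by apply: HM; rewrite -addnA addnCA leq_addr.
Qed.

End block_estimates.

(** * The rate condition *)

Section rate_condition.
Context (d : measure_display) (T : measurableType d) (R : realType).
Variables (P : probability T R) (X : nat -> {RV P >-> R}).

(** Since [n >= M >= 1] gives [n^t <= n^u], the larger exponent tests fewer [k]. *)
Lemma rate_condition_le (w : T) (t u : R) : t <= u ->
  rate_condition X w t -> rate_condition X w u.
Proof.
move=> tu [M [M0 HM]]; exists M; split => // n Mn k k0 nk; apply: HM => //.
by apply: le_trans nk; rewrite ler_powR// ler1n (leq_trans M0).
Qed.

Lemma measurable_rate_condition (t : R) :
  measurable [set w | rate_condition X w t].
Proof.
pose c := fine 'E_P[X 0%N].
pose A n k := [set w | `|k%:R^-1 * (\sum_(i < k) X i w) - c| < n%:R^-1 :> R].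
have -> : [set w | rate_condition X w t] =
    \bigcup_(M in [set M | (0 < M)%N]) \bigcap_(n in [set n | (M <= n)%N])
    \bigcap_(k in [set k | (0 < k)%N /\ n%:R `^ t <= k%:R]) A n k.
  apply/seteqP; split => w.
    by move=> [M [M0 HM]]; exists M => // n Mn k [k0 nk]; exact: HM.
  by move=> [M M0 HM]; exists M; split => // n Mn k k0 nk; apply: (HM n Mn k).
apply: bigcup_measurable => M _; apply: bigcap_measurableType => n _.
apply: bigcap_measurableType => k _.
have mf : measurable_fun setT
    (fun w => `|k%:R^-1 * (\sum_(i < k) X i w) - c|).
  apply: measurableT_comp => //; apply: measurable_funB => //.
  by apply: measurable_funM => //; exact: measurable_sum.
have -> : A n k = (fun w => `|k%:R^-1 * (\sum_(i < k) X i w) - c|)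
    @^-1` `]-oo, n%:R^-1[.
  by apply/seteqP; split => w; rewrite /A /= in_itv.
by rewrite -[X in measurable X]setTI; apply: mf.
Qed.

Lemma normr_mean_block (c : R) (k : nat) (w : T) : (0 < k)%N ->
  `|k%:R^-1 * (\sum_(i < k) X i w) - c| = `|block X c 0 k w| / k%:R.
Proof.
move=> k0; have kR : 0 < k%:R :> R by rewrite ltr0n.
rewrite (_ : _ - c = block X c 0 k w / k%:R).
  by rewrite normrM normfV (gtr0_norm kR).
rewrite /block sumrB sumr_const card_ord -[c *+ k]mulr_natr mulrBl mulfK ?gt_eqF//.
by rewrite mulrC.
Qed.

(** If [k >= n^t], the bound on the partial sum makes the deviation of the mean less than
    [k^(-1/t) <= 1/n]. *)
Lemma rate_condition_of_block (w : T) (t : R) : 2 < t ->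
  (exists M, forall n, (M <= n)%N ->
    `|block X (fine 'E_P[X 0%N]) 0 n.+1 w| < n.+1%:R `^ (1 - t^-1)) ->
  rate_condition X w t.
Proof.
move=> t2 [M HM]; have t0 : 0 < t by lra.
exists M.+1; split => // n Mn [//|k] _ nk.
have n1 : 1 <= n%:R :> R by rewrite ler1n (leq_trans _ Mn).
have n0 : 0 < n%:R :> R by lra.
have k0 : 0 < k.+1%:R :> R by [].
rewrite normr_mean_block// ltr_pdivrMr//.
(* As [t > 1], the number of summands is at least [n], hence beyond [M]. *)
have nk' : (n <= k.+1)%N.
  rewrite -(ler_nat R) (le_trans _ nk)// -[leLHS](powRr1 (ltW n0)).
  by rewrite ler_powR//; lra.
apply: lt_le_trans (HM k _) _; first by rewrite -ltnS (leq_trans Mn).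
rewrite powRB; last by apply/implyP => _; rewrite gt_eqF.
rewrite (powRr1 (ltW k0)) [leRHS]mulrC ler_pM2l// lef_pV2 ?posrE ?powR_gt0//.
have -> : n%:R = (n%:R `^ t) `^ t^-1 :> R.
  by rewrite -powRrM mulfV ?gt_eqF// (powRr1 (ltW n0)).
by rewrite ge0_ler_powR ?nnegrE ?powR_ge0 ?invr_ge0 ?(ltW t0) ?(ltW k0).
Qed.

(** Taking [n = 2^i] and [k = n^2 = 4^i] bounds the centred partial sum at [4^i] by [2^i]; the block
    is a difference of two of these, and [2^(j + 1) + 2^j = 3 * 2^j]. *)
Lemma block_of_rate_condition (w : T) : rate_condition X w 2 ->
  exists M, forall j, (M <= j)%N ->
    block X (fine 'E_P[X 0%N]) (4 ^ j) (3 * 4 ^ j) w < 3 * 2 ^+ j.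
Proof.
set c := fine _; move=> [M [M0 HM]]; exists M => j Mj.
have small i : (M <= i)%N -> `|block X c 0 (4 ^ i) w| < 2 ^+ i.
  move=> Mi; have i4 : (0 < 4 ^ i)%N by rewrite expn_gt0.
  have E4 : (4 ^ i)%:R = 2 ^+ i * 2 ^+ i :> R.
    by rewrite -exprMn natrX; congr (_ ^+ _); rewrite -natrM.
  have p2 : 0 < 2 ^+ i :> R by rewrite exprn_gt0.
  have := HM (2 ^ i)%N (leq_trans Mi (ltnW (ltn_expl i (isT : (1 < 2)%N)))) _ i4.
  rewrite normr_mean_block// ltr_pdivrMr ?ltr0n// E4 natrX mulKf ?gt_eqF//.
  apply; rewrite (powR_mulrn _ (ltW p2)).
  by rewrite expr2.
have := small j Mj; have := small j.+1 (leqW Mj).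
rewrite expnS (_ : (4 * 4 ^ j = 4 ^ j + 3 * 4 ^ j)%N); last by rewrite -mulSn.
rewrite block_cat add0n exprS !ltr_norml; lra.
Qed.

End rate_condition.

Theorem theorem30 (d : measure_display) (T : measurableType d) (R : realType)
    (P : probability T R) (X : nat -> {RV P >-> R})
    (hind : mutually_independent X)
    (hid : identically_distributed X)
    (hvar : (0 < 'V_P[X 0%N])%E)
    (hbnd : exists a b : R, a < b /\ {ae P, forall w, a <= X 0%N w <= b}) :
  measurable [set w | forall t : R, 0 < t -> (rate_condition X w t <-> 2 < t)]
  /\ {ae P, forall w, forall t : R, 0 < t -> (rate_condition X w t <-> 2 < t)}.
Proof.
pose r (m : nat) : R := 2 + m.+1%:R^-1.
have r2 m : 2 < r m by rewrite ltrDl invr_gt0.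
(* By monotonicity, failure at 2 excludes every [t <= 2], and every [t > 2] exceeds some [r m];
   countably many exponents remain. *)
have rE w : (forall t : R, 0 < t -> (rate_condition X w t <-> 2 < t)) <->
    ~ rate_condition X w 2 /\ forall m, rate_condition X w (r m).
  split=> [H|[H2 Hr] t t0].
    split; first by move/(H 2 (ltr0Sn _ _)); rewrite ltxx.
    by move=> m; apply/H => //; apply: lt_trans (r2 m); rewrite ltr0n.
  split=> [Ht|t2].
    by rewrite ltNge; apply/negP => t2; apply: H2; exact: rate_condition_le Ht.
  have [m Hm] := ltr_add_invr t2; exact: rate_condition_le (ltW Hm) (Hr m).
split.
  have -> : [set w | forall t : R, 0 < t -> (rate_condition X w t <-> 2 < t)] =
      ~` [set w | rate_condition X w 2] `&`
      \bigcap_m [set w | rate_condition X w (r m)].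
    apply/seteqP; split => w.
      by move=> /rE[H2 Hr]; split => // m _; exact: Hr.
    by move=> [H2 Hr]; apply/rE; split => // m; exact: Hr.
  apply: measurableI.
    by apply: measurableC; exact: measurable_rate_condition.
  by apply: bigcapT_measurable => m; exact: measurable_rate_condition.
have [a [b [ab Xab]]] := hbnd.
set c := fine 'E_P[X 0%N]; set s := fine 'V_P[X 0%N].
(* Boundedness makes the variance finite, so its positivity passes to the real number [s]; [l = 0]
   meets the smallness condition trivially. *)
have s0 : 0 < s.
  have [|Vs _] := @mgf_bounds _ _ _ P (X 0%N) a b 0 ab Xab.
    by rewrite normr0 mul0r.
  by rewrite -lte_fin /s -Vs.
have C0 : 0 < b - a by rewrite subr_gt0.
have mgf l : `|l| * (b - a) <= 2^-1 ->
    exists M, (\int[P]_w (expR (l * (X 0%N w - c)))%:E)%E = M%:E /\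
      1 + l ^+ 2 * s / 4 <= M <= 1 + 2 * (l ^+ 2 * s).
  by move=> lab; have [] := mgf_bounds ab Xab lab.
have low := block_lower_ae hind hid s0 C0 mgf.
(* The null sets for the various [m] are countably many, so one null set serves all of them. *)
have up : {ae P, forall w m, exists M, forall n, (M <= n)%N ->
    `|block X c 0 n.+1 w| < n.+1%:R `^ (1 - (r m)^-1)}.
  by apply: ae_foralln => m; exact: (block_upper_ae hind hid s0 C0 mgf (r2 m)).
apply: filterS2 low up => w low up; apply/rE; split.
  by move/block_of_rate_condition.
by move=> m; apply: rate_condition_of_block.
Qed.
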